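(* Let $N=\{1,\dots,n\}$ with $n\ge 2$, let $\Omega$ be a finite set with $|\Omega|\ge 2$, let $X$ be a finite set with $|X|\ge 3$, and let $\mathcal{D}$ be the domain of strict subjective expected utility preferences over acts in $X^{\Omega}$. A social choice function $\varphi:\mathcal{D}^n\to X^{\Omega}$ is unanimous and OSP implementable if and only if it is dictatorial.
   Context: **Setting.** $N=\{1,\dots,n\}$ is the set of agents, $\Omega$ the finite set of states, $X$ the set of outcomes. An act is a function $f:\Omega\to X$; $X^{\Omega}$ is the set of all acts. **Preferences.** $\mathcal{V}$ is the set of injective functions $v:X\to\mathbb{R}$ normalized by $\max_{x\in X} v(x)=1$ and $\min_{x\in X} v(x)=0$. For $v\in\mathcal{V}$, $\tau(v)$ denotes the unique maximizer of $v$ on $X$. $\mathcal{P}$ is the set of probability measures $p:2^{\Omega}\to[0,1]$ that are injective, i.e. $p(A)\neq p(B)$ whenever $A\ne B$ are subsets of $\Omega$. For $(v,p)\in\mathcal{V}\times\mathcal{P}$ and an act $h$, put $E_p^v(h)=\sum_{\omega\in\Omega}p(\omega)\,v(h(\omega))$, where $p(\omega)=p(\{\omega\})$. The domain of strict subjective expected utility preferences is $$\mathcal{D}=\{(v,p)\in\mathcal{V}\times\mathcal{P}: E_p^v(f)\ne E_p^v(g)\text{ for all acts } f\neq g\}.$$ A profile is written $(v,p)=((v_1,p_1),\dots,(v_n,p_n))\in\mathcal{D}^n$. **Social choice functions.** A social choice function (SCF) is a map $\varphi:\mathcal{D}^n\to X^{\Omega}$; $\varphi(v,p;\omega)$ denotes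 the value of the act $\varphi(v,p)$ at state $\omega$. - $\varphi$ is *unanimous* if for all $(v,p)\in\mathcal{D}^n$ and all $f\in X^{\Omega}$: if $E_{p_i}^{v_i}(f)\ge E_{p_i}^{v_i}(g)$ for all $g\in X^{\Omega}$ and all $i\in N$, then $\varphi(v,p)=f$. - $\varphi$ is *dictatorial* if there is $i\in N$ such that $\varphi(v,p;\omega)=\tau(v_i)$ for all $(v,p)\in\mathcal{D}^n$ and all $\omega\in\Omega$. **Mechanisms.** A mechanism is a tuple $G=\langle R,h,\iota,\alpha\rangle$ where: 1. $R$ is a rooted tree with root $r$, set of leaves $L(R)$ and set of internal nodes $V(R)$. For $\mathrm{v}\in V(R)$, $E(\mathrm{v})$ is the set of outgoing edges from $\mathrm{v}$; $\bar E(R)=\bigcup_{\mathrm{v}\in V(R)}E(\mathrm{v})$; for $e\in\bar E(R)$, $\rho(e)\in V(R)$ is the source node of $e$. 2. $h:L(R)\to X^{\Omega}$ assigns an act to each leaf. 3. $\iota:V(R)\to N$ specifies which agent acts at each internal node. 4. $\alpha:\bar E(R)\to 2^{\mathcal{D}}\setminus\{\emptyset\}$ satisfies: (4.1) if $e\ne e'$ and $\rho(e)=\rho(e')$, then $\alpha(e)\cap\alpha(e')=\emptyset$; (4.2) for each $\mathrm{v}\in V(R)$, $\bigcup_{e\in E(\mathrm{v})}\alpha(e)=\alpha(e')$, where $e'$ is the most recent edge on the path from $r$ to $\mathrm{v}$ with $\iota(\rho(e'))=\iota(\mathrm{v})$, or, if there is no such edge, $\bigcup_{e\in E(\mathrm{v})}\alpha(e)=\mathcal{D}$.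 Each profile $(v,p)\in\mathcal{D}^n$ induces a unique path from $r$ to a leaf: at each internal node $\mathrm{v}$ reached, with $i=\iota(\mathrm{v})$, the path follows the edge $e\in E(\mathrm{v})$ with $(v_i,p_i)\in\alpha(e)$. (It is part of the notion of mechanism that this path ends at a leaf for every profile.) $\varphi^G(v,p)\in X^{\Omega}$ denotes the act assigned by $h$ to that leaf, and $\varphi^G$ is the SCF implemented by $G$. **Obvious strategy-proofness.** Two preferences $(v_i,p_i),(v_i',p_i')\in\mathcal{D}$ of agent $i$ *diverge* at a node $\mathrm{v}\in V(R)$ if there are two distinct edges $e,e'\in E(\mathrm{v})$ with $(v_i,p_i)\in\alpha(e)$ and $(v_i',p_i')\in\alpha(e')$. The mechanism $G$ is *OSP* if for all $i\in N$, all $\mathrm{v}\in V(R)$ with $\iota(\mathrm{v})=i$, and all $(v,p),(v',p')\in\mathcal{D}^n$ such that $(v_i,p_i)$ and $(v_i',p_i')$ diverge at $\mathrm{v}$, we have $E_{p_i}^{v_i}(\varphi^G(v,p))\ge E_{p_i}^{v_i}(\varphi^G(v',p'))$. An SCF $\varphi$ is *OSP implementable* if there is an OSP mechanism $G$ with $\varphi=\varphi^G$. *)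

(* Defs.v *)
From mathcomp Require Import all_boot all_order all_algebra.
From mathcomp Require Import boolp classical_sets reals.

Set Implicit Arguments.
Unset Strict Implicit.
Unset Printing Implicit Defensive.

Import Order.TTheory GRing.Theory Num.Theory.
Local Open Scope ring_scope.

Definition act (Omega X : finType) := {ffun Omega -> X}.

Section Preferences.
Variables (R : realType) (Omega X : finType).

Definition is_utility (v : {ffun X -> R}) : Prop :=
  [/\ injective v,
      (forall x, v x <= 1) /\ (exists x, v x = 1) &
      (forall x, 0 <= v x) /\ (exists x, v x = 0)].

(* Only finite additivity is required, since Omega is finite. *)
Definition is_probability (p : {ffun {set Omega} -> R}) : Prop :=
  [/\ forall A, 0 <= p A <= 1,
      p [set: Omega]%SET = 1 &
      forall A B : {set Omega},
        [disjoint A & B] -> p (A :|: B)%SET = p A + p B].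

Definition is_belief (p : {ffun {set Omega} -> R}) : Prop :=
  is_probability p /\ injective p.

Definition expected_utility (v : {ffun X -> R}) (p : {ffun {set Omega} -> R})
    (f : act Omega X) : R :=
  \sum_(w : Omega) p [set w]%SET * v (f w).

(* The domain of strict subjective expected utility preferences, as a type. *)
Record pref := Pref {
  util : {ffun X -> R};
  belief : {ffun {set Omega} -> R};
  util_utility : is_utility util;
  belief_belief : is_belief belief;
  pref_strict : forall f g : act Omega X, f <> g ->
    expected_utility util belief f <> expected_utility util belief g
}.

Definition seu (P : pref) (f : act Omega X) : R :=
  expected_utility (util P) (belief P) f.

Lemma util_has_top (v : {ffun X -> R}) :
  is_utility v -> exists x, [forall y, v y <= v x].
Proof.
by case=> _ [le1 [x vx]] _; exists x; apply/forallP => y; rewrite vx.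
Qed.

(* The maximizer of the utility on X; it is unique, utilities being injective. *)
Definition top (P : pref) : X := xchoose (util_has_top (util_utility P)).

End Preferences.

Definition profile (R : realType) (n : nat) (Omega X : finType) :=
  {ffun 'I_n -> pref R Omega X}.

Definition scf (R : realType) (n : nat) (Omega X : finType) :=
  profile R n Omega X -> act Omega X.

Definition unanimous (R : realType) (n : nat) (Omega X : finType)
    (phi : scf R n Omega X) : Prop :=
  forall (P : profile R n Omega X) (f : act Omega X),
    (forall (g : act Omega X) (i : 'I_n), seu (P i) f >= seu (P i) g) ->
    phi P = f.

Definition dictatorial (R : realType) (n : nat) (Omega X : finType)
    (phi : scf R n Omega X) : Prop :=
  exists i : 'I_n, forall (P : profile R n Omega X) (w : Omega),
    phi P w = top (P i).

(* [walk src tgt x s y]: the edges [s], in order, form a directed path from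
   [x] to [y]. *)
Fixpoint walk (V L E : Type) (src : E -> V) (tgt : E -> V + L)
    (x : V + L) (s : seq E) (y : V + L) : Prop :=
  match s with
  | [::] => x = y
  | e :: s' => x = inl (src e) /\ walk src tgt (tgt e) s' y
  end.

(* A rooted tree, with edges directed away from the root: each node is the end
   of exactly one directed path from the root. Nodes are split into internal
   nodes (those with an outgoing edge) and leaves. Neither the degrees nor the
   depth are assumed to be finite, but each node has finite depth. *)
Record rooted_tree := RootedTree {
  inode : Type;
  leaf : Type;
  edge : Type;
  src : edge -> inode;
  tgt : edge -> inode + leaf;
  root : inode + leaf;
  inode_out : forall v : inode, exists e, src e = v;
  root_path : forall x : inode + leaf, exists! s : seq edge, walk src tgt root s x
}.

Definition out_edges (T : rooted_tree) (v : inode T) : set (edge T) :=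
  [set e | src e = v]%classic.

Definition path_to (T : rooted_tree) (s : seq (edge T)) (x : inode T + leaf T) :
    Prop :=
  walk (@src T) (@tgt T) (root T) s x.

Section Mechanisms.
Local Open Scope classical_set_scope.
Variables (R : realType) (n : nat) (Omega X : finType).

Local Notation pref := (pref R Omega X).
Local Notation profile := (profile R n Omega X).

(* The most recent edge of the path [s] at whose source agent [i] acts. *)
Definition last_move (T : rooted_tree) (iota : inode T -> 'I_n) (i : 'I_n)
    (s : seq (edge T)) : option (edge T) :=
  ohead (rev [seq e <- s | iota (src e) == i]).

(* Along [s], every edge taken is the choice of the agent acting at its
   source. *)
Definition follows (T : rooted_tree) (iota : inode T -> 'I_n)
    (alpha : edge T -> set pref) (P : profile) (s : seq (edge T)) : Prop :=
  all (fun e => P (iota (src e)) \in alpha e) s.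

Record mechanism := Mechanism {
  tree :> rooted_tree;
  assigned : leaf tree -> act Omega X;
  agent : inode tree -> 'I_n;
  alpha : edge tree -> set pref;
  alpha_neq0 : forall e, alpha e !=set0;
  alpha_disjoint : forall e e' : edge tree, e <> e' -> src e = src e' ->
    alpha e `&` alpha e' = classical_sets.set0;
  alpha_cover : forall (v : inode tree) (s : seq (edge tree)),
    path_to s (inl v) ->
    \bigcup_(e in out_edges v) alpha e =
      if last_move agent (agent v) s is Some e' then alpha e'
      else classical_sets.setT;
  alpha_ends : forall P : profile, exists (l : leaf tree) (s : seq (edge tree)),
    path_to s (inr l) /\ follows agent alpha P s
}.

(* By [alpha_disjoint], the leaf is determined by the profile, so that the
   choice made by [cid] is immaterial. *)
Definition final_leaf (G : mechanism) (P : profile) : leaf G :=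
  projT1 (cid (alpha_ends G P)).

Definition mech_scf (G : mechanism) : scf R n Omega X :=
  fun P => assigned (final_leaf G P).

Definition diverge (G : mechanism) (v : inode G) (q q' : pref) : Prop :=
  exists e e' : edge G,
    [/\ e <> e', out_edges v e, out_edges v e', alpha e q & alpha e' q'].

(* The profiles compared are not required to reach [v]: only the preferences of
   the agent acting at [v] are restricted. *)
Definition osp (G : mechanism) : Prop :=
  forall (i : 'I_n) (v : inode G), agent v = i ->
  forall P P' : profile, diverge v (P i) (P' i) ->
    seu (P i) (mech_scf G P) >= seu (P i) (mech_scf G P').

Definition osp_implementable (phi : scf R n Omega X) : Prop :=
  exists G : mechanism, osp G /\ phi = mech_scf G.

End Mechanisms.

(* Main.v *)
(** Under obvious strategy-proofness, two preferences q, q' of an agent j either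
    give the same outcome for all reports of the others, or every act that can
    follow q is weakly better for q than every act that can follow q'. With
    unanimity this makes the rule depend only on tops: if q, q' have the same
    top a and are distinguished, both force the constant act a. If tops a and b
    are distinguished for j, a preference ranking b almost as high as a shows
    that reporting a leads only to acts with values in {a, b}; applying this to
    two different b leaves the constant act a. Having three outcomes, an agent
    who distinguishes something is thus a dictator, and if nobody does, the
    rule is constant, contradicting unanimity. *)
Require Import Defs.
From mathcomp Require Import all_boot all_order all_algebra.
From mathcomp Require Import boolp classical_sets reals.
From mathcomp Require Import zify ring.

Set Implicit Arguments.
Unset Strict Implicit.
Unset Printing Implicit Defensive.

Import Order.TTheory GRing.Theory Num.Theory.

(** * Uniqueness of binary expansions *)

Lemma binary_digits_inj N (b c : nat -> bool) :
  \sum_(k < N) b k * 2 ^ k = \sum_(k < N) c k * 2 ^ k ->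
  forall k, k < N -> b k = c k.
Proof.
elim: N b c => [//|N IH] b c.
(* Parity reads off digit 0; halving what remains shifts the digits down, which sets up the
   induction hypothesis. *)
have split0 (d : nat -> bool) :
    \sum_(k < N.+1) d k * 2 ^ k = d 0 + (\sum_(k < N) d k.+1 * 2 ^ k).*2.
  rewrite big_ord_recl /= muln1 -mul2n big_distrr /=; congr (_ + _).
  by apply: eq_bigr => i _; rewrite /bump /= add1n expnS mulnCA.
rewrite !split0 => E.
have E0 : b 0 = c 0.
  by have /(congr1 odd) := E; rewrite !oddD !odd_double !addbF; case: (b 0) (c 0) => [] [].
have {E} /(IH (b \o succn) (c \o succn)) E1 :
    \sum_(k < N) b k.+1 * 2 ^ k = \sum_(k < N) c k.+1 * 2 ^ k.
  by apply: double_inj; apply/eqP; move/eqP: E; rewrite E0 eqn_add2l.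
by case=> [//|k]; apply: E1.
Qed.

(** The binary digits of the sum are the indicator of the image of the set under [phi], and [phi] is
    injective. *)
Lemma sum_pow2_inj (T : finType) (phi : T -> nat) (A B : {set T}) :
  injective phi ->
  \sum_(t in A) 2 ^ phi t = \sum_(t in B) 2 ^ phi t -> A = B.
Proof.
move=> phi_inj E.
pose N := \max_t phi t.
pose h t : 'I_N.+1 := inord (phi t).
have hE t : h t = phi t :> nat by rewrite inordK // ltnS leq_bigmax.
have h_inj : injective h by move=> s t /(congr1 val); rewrite /= !hE => /phi_inj.
have bits (C : {set T}) : \sum_(t in C) 2 ^ phi t =
    \sum_(k < N.+1) (inord k \in h @: C) * 2 ^ k.
  transitivity (\sum_(k in h @: C) 2 ^ k).
    rewrite big_imset /=; last by move=> ? ? _ _; apply: h_inj.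
    by apply: eq_bigr => t _; rewrite hE.
  rewrite big_mkcond; apply: eq_bigr => k _; rewrite inord_val.
  by case: ifP => _; rewrite ?mul1n.
move: E; rewrite !bits.
move=> /(@binary_digits_inj _ (fun k => inord k \in h @: A)
                              (fun k => inord k \in h @: B)) E.
apply: (imset_inj h_inj); apply/setP => k.
by have := E k (ltn_ord k); rewrite inord_val.
Qed.

Lemma sum_pow2_lt N : \sum_(k < N) 2 ^ k < 2 ^ N.
Proof.
elim: N => [|N IH]; first by rewrite big_ord0.
by rewrite big_ord_recr /= expnS mul2n -addnn ltn_add2r.
Qed.

Local Open Scope ring_scope.

(** * Best acts, and a preference with two prescribed best outcomes *)

Section Preferences.
Variables (R : realType) (Omega X : finType).
Local Notation pref := (pref R Omega X).
Local Notation const x := ([ffun=> x] : act Omega X).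

Lemma util_top (q : pref) : util q (Defs.top q) = 1.
Proof.
case: (util_utility q) => _ [le1 [x vx]] _.
apply/eqP; rewrite eq_le le1 /=.
by rewrite -vx; apply: (forallP (xchooseP (util_has_top (util_utility q)))).
Qed.

Lemma topP (q : pref) x : util q x = 1 -> Defs.top q = x.
Proof. by case: (util_utility q) => inj _ _ vx; apply: inj; rewrite util_top vx. Qed.

Lemma seu_le_top (q : pref) (f : act Omega X) :
  seu q f <= seu q (const (Defs.top q)).
Proof.
apply: ler_sum => w _; rewrite ffunE util_top.
case: (util_utility q) => _ [le1 _] _.
case: (belief_belief q) => [[p01 _ _] _].
by apply: ler_wpM2l => //; case/andP: (p01 [set w]%SET).
Qed.

(** Strictness makes the best act unique. *)
Lemma seu_ge_top (q : pref) (f : act Omega X) :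
  seu q (const (Defs.top q)) <= seu q f -> f = const (Defs.top q).
Proof.
move=> ge; apply: contrapT => /(pref_strict (p := q)); apply.
by apply/eqP; rewrite eq_le -!/(seu q _) ge seu_le_top.
Qed.

(* [a] has utility 1 and [b] nearly 1, while any other outcome costs so much
   more than [b] that no positive probability of it is worth risking. *)
Lemma exists_two_top_pref (a b : X) : a != b -> (0 < #|Omega|)%N ->
  exists q : pref, Defs.top q = a /\
    forall f : act Omega X, seu q (const b) <= seu q f ->
      forall w, f w = a \/ f w = b.
Proof.
move=> ab m_gt0; pose m := #|Omega|.
(* With this enumeration [a] has index 0, [b] has index 1 and every other outcome has index at least
   2. *)
pose s := [:: a, b & [seq x <- enum X | x \notin [:: a; b]]].
have s_uniq : uniq s.
  rewrite /= !inE (negbTE ab) !mem_filter !inE !eqxx ?orbT /=.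
  by rewrite filter_uniq // enum_uniq.
have s_mem x : x \in s.
  by rewrite !inE mem_filter mem_enum !inE; case: (x == a); case: (x == b).
pose ix x := index x s.
have ix_inj : injective ix by move=> x y; apply: index_inj.
pose M := (size s).-1.
have ixM x : (ix x <= M)%N by have := s_mem x; rewrite -index_mem.
have ixlast : ix (last a s) = M := index_last s_uniq.
have M_gt0 : (0 < M)%N by [].
(* Each unit of index multiplies the loss by [2 ^ m], which exceeds the total weight [S] of all
   states. The belief will be proportional to [2 ^ enum_rank w], and [L f] is the unnormalized
   expected loss. *)
pose loss x := (2 ^ (m * ix x))%N.
pose S := (\sum_(w : Omega) 2 ^ enum_rank w)%N.
pose L (f : act Omega X) := (\sum_(w : Omega) 2 ^ enum_rank w * loss (f w))%N.
have S_gt0 : (0 < S)%N.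
  case/card_gt0P: m_gt0 => w _.
  by rewrite /S (bigD1 w) //= addn_gt0 expn_gt0.
have S_lt : (S < 2 ^ m)%N.
  rewrite /S (reindex_onto enum_val enum_rank) /=; last by move=> *; rewrite enum_rankK.
  rewrite (eq_big xpredT (fun k : 'I_#|Omega| => 2 ^ k)%N) ?sum_pow2_lt //.
    by move=> k; rewrite enum_valK eqxx.
  by move=> k _; rewrite enum_valK.
(* [L f] is a sum of powers of 2 whose exponents encode the pairs [(w, f w)]: the quotient of an
   exponent by [m] is the index of the outcome, the remainder is the rank of the state. So [L f]
   determines the graph of [f]. *)
have L_inj : injective L.
  pose phi (t : Omega * X) := (enum_rank t.1 + m * ix t.2)%N.
  have phi_inj : injective phi.
    move=> [w x] [w' x'] E.
    have lt (u : Omega) : (enum_rank u < m)%N by apply: ltn_ord.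
    have /= := congr1 (fun k => k %/ m)%N E.
    rewrite /phi /= !(addnC (nat_of_ord _)) !(mulnC m) !divnMDl // !divn_small // !addn0.
    move=> /ix_inj xx'; move: E; rewrite /phi /= xx' => /addIn /val_inj /enum_rank_inj.
    by move=> ->.
  pose graph (f : act Omega X) := [set (w, f w) | w : Omega]%SET.
  have LE f : L f = (\sum_(t in graph f) 2 ^ phi t)%N.
    rewrite big_imset /=; last by move=> ? ? _ _ [].
    by apply: eq_bigr => w _; rewrite /phi /= expnD.
  move=> f g; rewrite !LE => /(sum_pow2_inj phi_inj) E.
  apply/ffunP => w; have : (w, f w) \in graph g by rewrite -E; apply: imset_f.
  by case/imsetP => w' _ [<-].
have S_neq0 : S%:R != 0 :> R by rewrite pnatr_eq0 -lt0n.
(* Losses range from 1, at [a], to [2 ^ (m * M)], at the last outcome, so dividing by [D] puts the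
   utilities on the scale from 0 to 1. *)
pose D : R := (2 ^ (m * M))%:R - 1.
have D_gt0 : 0 < D.
  by rewrite subr_gt0 ltr1n -{1}(expn0 2) ltn_exp2l // muln_gt0 m_gt0.
have D_neq0 : D != 0 by rewrite gt_eqF.
pose v : {ffun X -> R} := [ffun x => ((2 ^ (m * M))%:R - (loss x)%:R) / D].
pose p : {ffun {set Omega} -> R} :=
  [ffun A : {set Omega} => (\sum_(w in A) 2 ^ enum_rank w)%N%:R / S%:R].
have pS (A : {set Omega}) : (\sum_(w in A) 2 ^ enum_rank w <= S)%N.
  by rewrite /S big_mkcond; apply: leq_sum => w _; case: ifP.
(* Expected utility is a decreasing affine function of [L f], so strictness follows from [L_inj] and
   comparing acts means comparing natural numbers. *)
have EUE f : expected_utility v p f = ((2 ^ (m * M))%:R - (L f)%:R / S%:R) / D.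
  have -> : (2 ^ (m * M))%:R = \sum_(w : Omega) (2 ^ enum_rank w)%:R / S%:R * (2 ^ (m * M))%:R :> R.
    by rewrite -!mulr_suml -natr_sum divff // mul1r.
  rewrite /L natr_sum [in X in _ - X]mulr_suml -sumrB mulr_suml; apply: eq_bigr => w _.
  by rewrite !ffunE big_set1 natrM; ring.
have v_util : is_utility v.
  split.
  - move=> x y; rewrite !ffunE => /(divIf D_neq0) /addrI /oppr_inj /eqP.
    rewrite eqr_nat eqn_exp2l // eqn_pmul2l // => /eqP; exact: ix_inj.
  - split; last first.
      by exists a; rewrite ffunE /loss /ix /= eqxx muln0 expn0 divff.
    move=> x; rewrite ffunE ler_pdivrMr // mul1r lerD2l lerN2 ler1n expn_gt0 //.
  - split; last by exists (last a s); rewrite ffunE /loss ixlast subrr mul0r.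
    move=> x; rewrite ffunE divr_ge0 ?(ltW D_gt0) // subr_ge0 ler_nat.
    by rewrite leq_pexp2l // leq_pmul2l.
have p_belief : is_belief p.
  split; last first.
    move=> A B; rewrite !ffunE => /(divIf S_neq0) /eqP; rewrite eqr_nat => /eqP.
    by apply: sum_pow2_inj => w w' /val_inj /enum_rank_inj.
  split.
  - move=> A; rewrite ffunE divr_ge0 //=.
    by rewrite ler_pdivrMr ?ltr0n // mul1r ler_nat.
  - rewrite ffunE; have -> : (\sum_(w in [set: Omega]%SET) 2 ^ enum_rank w)%N = S.
      by apply: eq_bigl => w; rewrite inE.
    by rewrite divff.
  - by move=> A B AB; rewrite !ffunE -mulrDl -natrD -bigU //=; congr (_%:R / _); apply: eq_bigl => w; rewrite !inE.
have strict f g : f <> g -> expected_utility v p f <> expected_utility v p g.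
  move=> fg; rewrite !EUE => /(divIf D_neq0) /addrI /oppr_inj /(divIf S_neq0) /eqP.
  by rewrite eqr_nat => /eqP /L_inj.
exists (Pref v_util p_belief strict); split.
  by apply: topP; rewrite /= ffunE /loss /ix /= eqxx muln0 expn0 divff.
move=> f; rewrite /seu /= !EUE ler_pM2r ?invr_gt0 // lerD2l lerN2.
rewrite ler_pM2r ?invr_gt0 ?ltr0n // ler_nat => Lf w.
apply: contrapT => /not_orP [/eqP fa /eqP fb].
(* The constant act [b] loses [S * 2 ^ m] in all, less than the loss [2 ^ (m * 2)] already incurred
   at one state with an outcome of index at least 2. *)
have Lb : (L (const b) < 2 ^ (m * 2))%N.
  have -> : L (const b) = (S * 2 ^ m)%N.
    rewrite /L /S big_distrl; apply: eq_bigr => u _.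
    by rewrite ffunE /loss /ix /= (negbTE ab) eqxx muln1.
  by rewrite muln2 -addnn expnD ltn_pmul2r // expn_gt0.
have : (2 ^ (m * 2) <= L f)%N.
  rewrite /L (bigD1 w) //=; apply: leq_trans (leq_addr _ _).
  apply: leq_trans (leq_pmull _ _); last by rewrite expn_gt0.
  rewrite /loss leq_pexp2l // leq_pmul2l // /ix /=.
  by rewrite [a == _]eq_sym [b == _]eq_sym (negbTE fa) (negbTE fb).
lia.
Qed.

End Preferences.

(** * The dichotomy between indistinguishable and mutually dominating reports *)

Section Mechanisms.
Variables (R : realType) (n : nat) (Omega X : finType).
Local Notation pref := (pref R Omega X).
Local Notation profile := (profile R n Omega X).
Local Notation const x := ([ffun=> x] : act Omega X).

Definition indistinguishable (phi : scf R n Omega X) (j : 'I_n) (q q' : pref) :=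
  forall P P' : profile, (forall i, i != j -> P i = P' i) ->
    P j = q -> P' j = q' -> phi P = phi P'.

(** The reports of the others in [P] and [P'] are unrelated: the worst case after [q] is set against
    the best case after [q']. *)
Definition dominates (phi : scf R n Omega X) (j : 'I_n) (q q' : pref) :=
  forall P P' : profile, P j = q -> P' j = q' -> seu q (phi P') <= seu q (phi P).

(** The two paths are compared edge by edge from a common node, where distinct edges would be a
    divergence of the acting agent. *)
Lemma mech_scf_eq (G : mechanism R n Omega X) (P P' : profile) :
  (forall v : inode G, ~ diverge v (P (agent v)) (P' (agent v))) ->
  mech_scf G P = mech_scf G P'.
Proof.
move=> nd; congr (assigned _); rewrite /final_leaf.
case: cid => /= l [s [ws fs]]; case: cid => /= l' [s' [ws' fs']].
move: ws fs ws' fs'; rewrite /path_to.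
elim: s s' (Defs.root G) => [|e s IH] [|e' s'] x /=.
- by move=> -> _ [->].
- by move=> -> _ [].
- by move=> [-> _] _.
move=> [-> ws] /andP[/set_mem ae fs] [[see'] ws'] /andP[/set_mem ae' fs'].
have ee' : e = e'.
  apply: contrapT => ne; apply: (nd (src e)); exists e, e'; split=> //; by rewrite see'.
by rewrite -ee' in ws' fs'; apply: IH ws fs ws' fs'.
Qed.

Lemma diverge_sym (G : mechanism R n Omega X) (v : inode G) (q q' : pref) :
  diverge v q q' -> diverge v q' q.
Proof. by case=> e [e' [/nesym ne oe oe' ae ae']]; exists e', e; split. Qed.

Lemma diverge_irrefl (G : mechanism R n Omega X) (v : inode G) (q : pref) :
  ~ diverge v q q.
Proof.
case=> e [e' [ne oe oe' ae ae']].
have: (alpha e `&` alpha e')%classic q by [].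
by rewrite alpha_disjoint //; rewrite oe oe'.
Qed.

(* The profiles compared in [osp] are unrestricted at the other agents, so a
   single divergence yields domination over all reports of the others. *)
Lemma osp_dichotomy (G : mechanism R n Omega X) : osp G -> forall j q q',
  indistinguishable (mech_scf G) j q q' \/
  dominates (mech_scf G) j q q' /\ dominates (mech_scf G) j q' q.
Proof.
move=> ospG j q q'.
have [[v [av dv]]|nd] := pselect (exists v : inode G, agent v = j /\ diverge v q q').
  right; split=> P P' Pj P'j; rewrite -[in X in X <= _]Pj -[in X in _ <= X]Pj.
    by apply: (ospG j v) => //; rewrite Pj P'j.
  by apply: (ospG j v) => //; rewrite Pj P'j; apply: diverge_sym.
left=> P P' PP' Pj P'j; apply: mech_scf_eq => v.
have [av|av] := eqVneq (agent v) j; last by rewrite PP' //; apply: diverge_irrefl.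
by rewrite av Pj P'j => dv; apply: nd; exists v.
Qed.

(** * Changing one report at a time *)

Definition upd (P : profile) (j : 'I_n) (q : pref) : profile :=
  [ffun i => if i == j then q else P i].

Lemma upd_same P j q : upd P j q j = q.
Proof. by rewrite ffunE eqxx. Qed.

Lemma upd_other P j q i : i != j -> upd P j q i = P i.
Proof. by rewrite ffunE => /negbTE ->. Qed.

Lemma indistinguishable_refl phi j q : indistinguishable phi j q q.
Proof.
move=> P P' PP' Pj P'j; congr (phi _); apply/ffunP => i.
by have [->|/PP'//] := eqVneq i j; rewrite Pj P'j.
Qed.

Lemma indistinguishable_sym phi j q q' :
  indistinguishable phi j q q' -> indistinguishable phi j q' q.
Proof. by move=> E P P' PP' Pj P'j; symmetry; apply: E => // i /PP' ->. Qed.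

Lemma indistinguishable_trans phi j q1 q2 q3 :
  indistinguishable phi j q1 q2 -> indistinguishable phi j q2 q3 ->
  indistinguishable phi j q1 q3.
Proof.
move=> E1 E2 P P' PP' Pj P'j; transitivity (phi (upd P j q2)).
  by apply: E1 => //; [move=> i /upd_other -> | apply: upd_same].
by apply: E2 => //; [move=> i ne; rewrite upd_other // PP' | apply: upd_same].
Qed.

Lemma indistinguishable_const phi :
  (forall j q q', indistinguishable phi j q q') -> forall P P', phi P = phi P'.
Proof.
move=> E P P'.
(* Hybrid profiles lead from [P] to [P'], consecutive ones differing at a single agent. *)
pose H k : profile := [ffun i : 'I_n => if (i < k)%N then P' i else P i].
have step k : (k <= n)%N -> phi (H k) = phi P.
  elim: k => [_|k IH kn]; first by congr (phi _); apply/ffunP => i; rewrite ffunE.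
  rewrite -IH ?(ltnW kn) //.
  apply: (E (Ordinal kn) _ _) => // i; rewrite -val_eqE /= => ik.
  by rewrite !ffunE ltnS leq_eqVlt (negbTE ik).
by rewrite -(step n) //; congr (phi _); apply/ffunP => i; rewrite ffunE ltn_ord.
Qed.

Lemma unanimous_top (phi : scf R n Omega X) (q : pref) :
  unanimous phi -> phi [ffun=> q] = const (Defs.top q).
Proof. by apply=> g i; rewrite ffunE; apply: seu_le_top. Qed.

(** * From the dichotomy to a dictator *)

Lemma dichotomy_dictatorial (phi : scf R n Omega X) :
  (0 < #|Omega|)%N -> (3 <= #|X|)%N -> unanimous phi ->
  (forall j q q', indistinguishable phi j q q' \/
     dominates phi j q q' /\ dominates phi j q' q) ->
  dictatorial phi.
Proof.
move=> hO hX un dich.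
have [w0 _] := card_gt0P hO.
have const_inj x y : const x = const y -> x = y.
  by move=> /ffunP /(_ w0); rewrite !ffunE.
have fresh (a b : X) : exists c, c != a /\ c != b.
  have : (0 < #|~: [set a; b]%SET|)%N.
    by rewrite cardsCs finset.setCK subn_gt0 cards2; apply: leq_trans hX; case: (a != b).
  by case/card_gt0P => c; rewrite !inE negb_or => /andP[]; exists c.
have pref_ex (a b : X) : a != b -> exists q : pref, Defs.top q = a /\
    forall f : act Omega X, seu q (const b) <= seu q f ->
      forall w, f w = a \/ f w = b.
  by move=> ab; apply: exists_two_top_pref.
have cpE (q : pref) (j : 'I_n) : ([ffun=> q] : profile) j = q by rewrite ffunE.
(* Otherwise each report dominates the other. Comparison with the unanimous profile of the other
   report, which yields the common best act, forces that act in both cases. *)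
have tops_only j q q' : Defs.top q = Defs.top q' -> indistinguishable phi j q q'.
  move=> tq; case: (dich j q q') => // -[d1 d2] P P' _ Pj P'j.
  have -> : phi P = const (Defs.top q).
    apply: seu_ge_top.
    by have := d1 P [ffun=> q'] Pj (cpE _ _); rewrite unanimous_top // tq.
  symmetry; rewrite tq; apply: seu_ge_top.
  by have := d2 P' [ffun=> q] P'j (cpE _ _); rewrite unanimous_top // tq.
(* By [tops_only], [q] may be replaced by [q2], which has the same top and for which the top of [q']
   is almost as good. Everyone reporting [q'] yields the constant act at that top, which [phi P]
   must match in the eyes of [q2]. *)
have two_tops j q q' (P : profile) : ~ indistinguishable phi j q q' -> P j = q ->
    forall w, phi P w = Defs.top q \/ phi P w = Defs.top q'.
  move=> nE Pj.
  have ab : Defs.top q != Defs.top q' by apply/eqP => /tops_only /nE.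
  have [q2 [t2 s2]] := pref_ex _ _ ab.
  have E2 : indistinguishable phi j q q2 by apply: tops_only.
  have nE2 : ~ indistinguishable phi j q2 q'.
    by move=> E; apply: nE; apply: indistinguishable_trans E2 E.
  case: (dich j q2 q') => // -[d _].
  have -> : phi P = phi (upd P j q2).
    by apply: E2 => //; [move=> i /upd_other -> | apply: upd_same].
  apply: s2; rewrite -(unanimous_top q' un).
  by apply: d; [apply: upd_same | apply: cpE].
(* If no agent ever matters, [phi] is constant, against unanimity at two profiles with different
   common tops. *)
have [triv|] := pselect (forall j q q', indistinguishable phi j q q').
  have [a _] : exists a : X, a \in predT by apply/card_gt0P; apply: leq_trans hX.
  have [b [ba _]] := fresh a a.
  have [qa [ta _]] := pref_ex _ _ (ltac:(by rewrite eq_sym) : a != b).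
  have [qb [tb _]] := pref_ex _ _ ba.
  have := indistinguishable_const triv [ffun=> qa] [ffun=> qb].
  by rewrite !unanimous_top // ta tb => /const_inj E; rewrite E eqxx in ba.
move=> /existsNP [j /existsNP [q1 /existsNP [q2 n12]]].
exists j => P w; set q := P j; set a := Defs.top q.
(* Indistinguishability is an equivalence relation, so [q] cannot be related to both [q1] and
   [q2]. *)
have [q' nq'] : exists q', ~ indistinguishable phi j q q'.
  have [E1|] := pselect (indistinguishable phi j q q1); last by exists q1.
  exists q2 => E2; apply: n12; apply: indistinguishable_trans E2.
  exact: indistinguishable_sym.
have ab : Defs.top q' != a by apply/eqP => /esym /tops_only /nq'.
have [c [ca cb]] := fresh a (Defs.top q').
have [r [tr _]] := pref_ex _ _ ca.
(* If [q] is distinguished from [r] as well as from [q'], the outcome lies in two pairs of outcomes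
   that share only [a]. *)
have [Er|nr] := pselect (indistinguishable phi j q r); last first.
  have := two_tops j q q' P nq' erefl w.
  case: (two_tops j q r P nr erefl w) => // ->; rewrite tr => -[] // E.
  by rewrite E eqxx in cb.
have nr : ~ indistinguishable phi j r q'.
  by move=> E; apply: nq'; apply: indistinguishable_trans Er E.
(* [a] and [c] are now interchangeable for [j], so a unanimous vote for [a]
   cannot result in [a]. *)
have := two_tops j r q' (upd [ffun=> q] j r) nr (upd_same _ _ _) w0.
have <- : phi [ffun=> q] = phi (upd [ffun=> q] j r).
  by apply: Er => //; [move=> i /upd_other -> | apply: upd_same].
rewrite unanimous_top // ffunE -/a tr => -[E|E].
  by rewrite E eqxx in ca.
by rewrite -E eqxx in ab.
Qed.

Lemma dictatorial_unanimous (phi : scf R n Omega X) :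
  dictatorial phi -> unanimous phi.
Proof.
case=> i di P f best.
have -> := seu_ge_top (best (const (Defs.top (P i))) i).
by apply/ffunP => w; rewrite di ffunE.
Qed.

(** * A one-move mechanism in which the dictator reports a whole preference *)

Definition star_src (q : pref) : unit := tt.
Definition star_tgt (q : pref) : unit + pref := inr q.

Lemma star_walkP (s : seq pref) (x : unit + pref) :
  walk star_src star_tgt (inl tt) s x <->
  s = if x is inr q then [:: q] else [::].
Proof.
split=> [|->]; last by case: x => [[]|q].
case: s => [/= <-//|q [|q' s]] /=; first by case=> _ <-.
by case=> _ [].
Qed.

Lemma star_out (q0 : pref) (v : unit) : exists q, star_src q = v.
Proof. by exists q0; case: v. Qed.

Lemma star_path (x : unit + pref) :
  exists! s, walk star_src star_tgt (inl tt) s x.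
Proof.
by exists (if x is inr q then [:: q] else [::]); split=> [|s /star_walkP ->//]; apply/star_walkP.
Qed.

(** The preference [q0] witnesses that the root has an outgoing edge. *)
Definition star (q0 : pref) : rooted_tree :=
  RootedTree (star_out q0) star_path.

Definition star_alpha (q : pref) : set pref := [set q]%classic.

Lemma star_alpha_disjoint (q q' : pref) : q <> q' -> star_src q = star_src q' ->
  (star_alpha q `&` star_alpha q' = classical_sets.set0)%classic.
Proof. by move=> ne _; apply/seteqP; split=> // p [/= -> /ne]. Qed.

(** The path to the only internal node is empty, so there is no earlier move and the edges have to
    cover the whole domain. *)
Lemma star_cover (q0 : pref) (i : 'I_n) (v : inode (star q0))
    (s : seq (edge (star q0))) : path_to s (inl v) ->
  (\bigcup_(e in out_edges v) star_alpha e =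
    if last_move (fun=> i) i s is Some e' then star_alpha e'
    else classical_sets.setT)%classic.
Proof.
move=> /star_walkP ->; apply/seteqP; split=> // q _.
by exists q => //; rewrite /out_edges /=; case: v.
Qed.

Lemma star_ends (q0 : pref) (i : 'I_n) (P : profile) :
  exists (l : leaf (star q0)) (s : seq (edge (star q0))),
    path_to s (inr l) /\ @follows R n Omega X (star q0) (fun=> i) star_alpha P s.
Proof.
exists (P i), [:: P i]; split; first exact/star_walkP.
by rewrite /follows /= andbT; apply/mem_set.
Qed.

Definition dictator_mechanism (q0 : pref) (i : 'I_n) : mechanism R n Omega X :=
  @Mechanism R n Omega X (star q0) (fun q => const (Defs.top q)) (fun=> i)
    star_alpha (fun q => ex_intro _ q erefl) star_alpha_disjoint
    (@star_cover q0 i) (@star_ends q0 i).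

Lemma dictator_mechanism_scf (q0 : pref) (i : 'I_n) (P : profile) :
  mech_scf (dictator_mechanism q0 i) P = const (Defs.top (P i)).
Proof.
rewrite /mech_scf; case: (projT2 (cid (alpha_ends (dictator_mechanism q0 i) P))).
rewrite -/(final_leaf _ P) => s [/star_walkP ->] /=.
by rewrite /follows /= andbT => /set_mem ->.
Qed.

Lemma dictatorial_osp_implementable (phi : scf R n Omega X) :
  pref -> dictatorial phi -> osp_implementable phi.
Proof.
move=> q0 [i di]; exists (dictator_mechanism q0 i); split.
  (* A truthful report gives the dictator the best of all acts. *)
  by move=> _ v <- P P' _; rewrite !dictator_mechanism_scf; apply: seu_le_top.
apply/funext => P; rewrite dictator_mechanism_scf.
by apply/ffunP => w; rewrite di ffunE.
Qed.

End Mechanisms.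

Theorem theorem1 (R : realType) (n : nat) (Omega X : finType)
    (hn : (2 <= n)%N) (hOmega : (2 <= #|Omega|)%N) (hX : (3 <= #|X|)%N)
    (phi : scf R n Omega X) :
  (unanimous phi /\ osp_implementable phi) <-> dictatorial phi.
Proof.
have hO : (0 < #|Omega|)%N by apply: ltnW.
split=> [[un [G [ospG E]]]|dict].
  by apply: dichotomy_dictatorial => // j q q'; rewrite E; apply: osp_dichotomy.
split; first exact: dictatorial_unanimous.
have [a [b [_ _ ab]]] : exists a b : X, [/\ a \in predT, b \in predT & a != b].
  by apply/card_gt1P; apply: ltnW.
(* The domain of preferences is nonempty, as the one-move tree requires. *)
have [q _] := exists_two_top_pref R ab hO.
exact: dictatorial_osp_implementable.
Qed.
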